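(* Let $D_1$ and $D_2$ be persistence diagrams. Then $D_1$ and $D_2$ are orthogonal if and only if for any pair of points $(b_1,d_1)\in D_1$ and $(b_2,d_2)\in D_2$, the open intervals $(b_1,d_1)_{\mathbb{R}}$ and $(b_2,d_2)_{\mathbb{R}}$ of $\mathbb{R}$ have an empty intersection.
   Context: A persistence diagram is a finite multiset $D$ (points may have multiplicities, and $D$ may be empty) of points $(b,d)\in\mathbb{R}^2$ with $b<d<\infty$. The notation $(b,d)$ is a point of a diagram, while $(b,d)_{\mathbb{R}}$ denotes the open interval $\{t\in\mathbb{R}\mid b<t<d\}$. Persistence landscape: if $D$ has points $(b_1,d_1),\dots,(b_n,d_n)$ (listed with multiplicity), let $g_i:\mathbb{R}\to\mathbb{R}$ be $g_i(t)=t-b_i$ for $t\in[b_i,(b_i+d_i)/2]$, $g_i(t)=d_i-t$ for $t\in[(b_i+d_i)/2,d_i]$, and $g_i(t)=0$ otherwise. For $j\ge1$ let $\lambda_j(t)$ be the $j$-th largest value (counted with multiplicity) among $g_1(t),\dots,g_n(t)$, with $\lambda_j(t)=0$ for $j>n$. The persistence landscape of $D$ is $\varphi(D)=(\lambda_1,\lambda_2,\dots)$; the empty diagram has zero landscape. For landscapes $\vec\lambda=(\lambda_j)_{j\ge1}$ and $\vec\mu=(\mu_j)_{j\ge1}$, the inner product is $\langle\vec\lambda,\vec\mu\rangle=\sum_{j=1}^\infty\int_{\mathbb{R}}\lambda_j(t)\mu_j(t)\,dt$. Diagrams $D_1$ and $D_2$ are orthogonal if $\langle\varphi(D_1),\varphi(D_2)\rangle=0$.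 *)

(* Defs.v *)
From mathcomp Require Export all_boot all_order all_algebra finmap multiset.
From mathcomp Require Export all_classical all_reals all_analysis.

Set Implicit Arguments.
Unset Strict Implicit.
Unset Printing Implicit Defensive.
Import Order.TTheory GRing.Theory Num.Theory.
Local Open Scope classical_set_scope.
Local Open Scope ring_scope.

Record persistence_diagram (R : realType) := PersistenceDiagram {
  points :> {mset (R * R)%type}%mset ;
  birth_lt_death : forall p : R * R, p \in points -> p.1 < p.2
}.

Definition tent (R : realType) (p : R * R) (t : R) : R :=
  let: (b, d) := p in
  if b <= t <= (b + d) / 2 then t - b
  else if (b + d) / 2 <= t <= d then d - t
  else 0.

(* Indexing is shifted by one: [landscape D j] is lambda_(j+1), the
   (j+1)-st largest value of the tent functions at [t].
   [enum_mset] lists each point as many times as its multiplicity, and the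
   default value of [nth] gives the zero functions beyond the number of
   points. *)
Definition landscape (R : realType) (D : persistence_diagram R)
    (j : nat) (t : R) : R :=
  nth 0 (sort >=%R [seq tent p t | p <- enum_mset D]) j.

(* The value is taken in the extended reals, so that the series and the
   integrals of products of (nonnegative) landscapes have no junk value. *)
Definition landscape_inner (R : realType) (lam mu : nat -> R -> R) : \bar R :=
  (\sum_(0 <= j <oo)
     \int[@lebesgue_measure R]_(t in [set: R]) (lam j t * mu j t)%:E)%E.

Definition orthogonal_diagrams (R : realType)
    (D1 D2 : persistence_diagram R) : Prop :=
  landscape_inner (landscape D1) (landscape D2) = 0%E.

(* Main.v *)
Require Import Defs.
From mathcomp Require Import lra.
Import Order.TTheory GRing.Theory Num.Theory.
Local Open Scope classical_set_scope.
Local Open Scope ring_scope.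

(** Landscapes are nonnegative, so the inner product vanishes as soon as each
product [lambda_j * mu_j] is zero everywhere, and only if the first integral
[int lambda_0 * mu_0] vanishes.

If some [lambda_j t * mu_j t] is nonzero, then both factors are nonzero values
of tents, so [t] lies in the open interval of a point of each diagram
([landscape_neq0_itv]): disjoint intervals make every product zero.

Conversely [lambda_0] is the pointwise maximum of the tents of its diagram
([tent_le_landscape0]).  If [(b1, d1)] and [(b2, d2)] have overlapping
intervals, both tents are at least some [w > 0] on the middle third of the
overlap ([tent_ge]).  That middle third has length [w], so the first integral
is at least [w ^+ 2 * w > 0] ([cst_measure_le_integral]). *)

Lemma tent_ge0 (R : realType) (p : R * R) (t : R) : 0 <= tent p t.
Proof.
case: p => b d; rewrite /tent.
by case: ifP => [/andP[]|_]; [|case: ifP => [/andP[]|//]]; lra.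
Qed.

Lemma tent_neq0_itv (R : realType) (b d t : R) :
  tent (b, d) t != 0 -> t \in `]b, d[.
Proof.
rewrite /tent in_itv /=.
case: ifP => [/andP[bt tm] /eqP t0|_]; last case: ifP => [/andP[mt td] /eqP t0|_].
- have : b != t by apply/eqP => bt'; apply: t0; lra.
  by rewrite neq_lt => /orP[|] ?; apply/andP; split; lra.
- have : t != d by apply/eqP => bt'; apply: t0; lra.
  by rewrite neq_lt => /orP[|] ?; apply/andP; split; lra.
- by rewrite eqxx.
Qed.

(** A tent grows with slope 1 from both endpoints, so at distance at least [w]
from each of them it has height at least [w]. *)
Lemma tent_ge (R : realType) (b d w t : R) :
  0 <= w -> b + w <= t <= d - w -> w <= tent (b, d) t.
Proof.
move=> w0 /andP[bt td]; rewrite /tent.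
have [tm|mt] := leP t ((b + d) / 2).
- by rewrite ifT; [lra | apply/andP; split; lra].
- by rewrite andbF ifT; [lra | apply/andP; split; lra].
Qed.

Lemma landscape_ge0 (R : realType) (D : persistence_diagram R) j t :
  0 <= landscape D j t.
Proof.
rewrite /landscape; set s := sort _ _.
have [js|sj] := ltnP j (size s); last by rewrite nth_default.
have := mem_nth 0 js; rewrite mem_sort => /mapP[p _ ->]; exact: tent_ge0.
Qed.

(** Values of a landscape are values of tents, except for the zero padding beyond
the number of points, which the hypothesis excludes. *)
Lemma landscape_neq0_itv (R : realType) (D : persistence_diagram R) j t :
  landscape D j t != 0 ->
  exists b d : R, (b, d) \in points D /\ t \in `]b, d[.
Proof.
rewrite /landscape; set s := sort _ _.
have [js|sj] := ltnP j (size s); last by rewrite nth_default ?eqxx.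
have := mem_nth 0 js; rewrite mem_sort => /mapP[[b d] bdD ->].
by move=> /tent_neq0_itv tbd; exists b, d.
Qed.

Lemma tent_le_landscape0 (R : realType) (D : persistence_diagram R) p t :
  p \in points D -> tent p t <= landscape D 0 t.
Proof.
move=> pD; rewrite /landscape; set s := sort _ _.
have : tent p t \in s by rewrite mem_sort; apply/mapP; exists p.
have : sorted >=%R s.
  by apply: sort_sorted => x y; exact: le_total.
case: s => // a s /= sa; rewrite inE => /predU1P[->//|ps].
(* The head of a list sorted by [>=] dominates its tail. *)
have ge_tr : transitive (>=%R : rel R) by move=> y x z xy yz; exact: le_trans yz xy.
by have /allP/(_ _ ps) := order_path_min ge_tr sa.
Qed.

Import HBNNSimple.

(** A Markov-type bound: the integral of a nonnegative function is the supremum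
of the integrals of the simple functions below it, and [c * \1_A] is one of
them.  Arguing on this supremum, rather than by monotonicity of the integral,
makes the bound applicable to landscapes without first proving that sorting
preserves measurability. *)
Lemma cst_measure_le_integral d (T : measurableType d) (R : realType)
    (mu : {measure set T -> \bar R}) (A : set T) (c : R) (f : T -> \bar R) :
  measurable A -> 0 <= c -> (forall x, (0 <= f x)%E) ->
  (forall x, A x -> (c%:E <= f x)%E) ->
  (c%:E * mu A <= \int[mu]_x f x)%E.
Proof.
move=> mA c0 f0 cf; rewrite ge0_integralTE//.
pose h := scale_nnsfun (indic_nnsfun R mA) c0.
have <- : sintegral mu h = (c%:E * mu A)%E by rewrite sintegralrM sintegral_indic.
apply: ereal_sup_ubound; exists h => // x; rewrite /= measurable_realfun.mindicE.
have [/set_mem Ax|_] := boolP (x \in A); first by rewrite mulr1 cf.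
by rewrite mulr0 f0.
Qed.

Theorem proposition3 (R : realType) (D1 D2 : persistence_diagram R) :
  orthogonal_diagrams D1 D2 <->
  (forall b1 d1 b2 d2 : R, (b1, d1) \in points D1 -> (b2, d2) \in points D2 ->
     `]b1, d1[ `&` `]b2, d2[ = set0).
Proof.
have f0 j t : (0 <= (landscape D1 j t * landscape D2 j t)%:E)%E.
  by rewrite lee_fin mulr_ge0// landscape_ge0.
split=> [orth b1 d1 b2 d2 p1 p2|disj]; last first.
  apply: eseries0 => j _ _; apply: integral0_eq => t _.
  have [->|/landscape_neq0_itv[b1 [d1 [p1 t1]]]] := eqVneq (landscape D1 j t) 0.
    by rewrite mul0r.
  have [->|/landscape_neq0_itv[b2 [d2 [p2 t2]]]] := eqVneq (landscape D2 j t) 0.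
    by rewrite mulr0.
  suff : (set0 : set R) t by [].
  by rewrite -(disj _ _ _ _ p1 p2); split.
rewrite -subset0 => t [] /=; rewrite !in_itv /= => /andP[b1t td1] /andP[b2t td2].
(* The overlap is ]a, c[, and `[a + w, c - w] is its middle third. *)
pose a := Num.max b1 b2; pose c := Num.min d1 d2; pose w := (c - a) / 3.
have b1a : b1 <= a by rewrite /a le_max lexx.
have b2a : b2 <= a by rewrite /a le_max lexx orbT.
have cd1 : c <= d1 by rewrite /c ge_min lexx.
have cd2 : c <= d2 by rewrite /c ge_min lexx orbT.
have aw : a < c by rewrite /a /c gt_max !lt_min; do ?[apply/andP; split]; lra.
have w0 : 0 < w by rewrite /w; lra.
have low x : x \in `[a + w, c - w] ->
    w ^+ 2 <= landscape D1 0 x * landscape D2 0 x.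
  rewrite in_itv /= expr2 => /andP[ax xc].
  apply: ler_pM; [lra | lra | |].
  - by apply: (le_trans _ (tent_le_landscape0 _ _ _ x p1)); apply: tent_ge; lra.
  - by apply: (le_trans _ (tent_le_landscape0 _ _ _ x p2)); apply: tent_ge; lra.
have : (0 < \int[lebesgue_measure]_x (landscape D1 0 x * landscape D2 0 x)%:E)%E.
  have le_int := @cst_measure_le_integral _ _ _ (@lebesgue_measure R)
    [set` `[a + w, c - w]] (w ^+ 2) _ (measurable_itv _) (sqr_ge0 w) (f0 0%N) low.
  apply: lt_le_trans le_int.
  rewrite [X in (_ * X)%E](lebesgue_measure_itv `[a + w, c - w]) /= lte_fin.
  rewrite ifT; last by rewrite /w; lra.
  by rewrite -EFinB -EFinM lte_fin mulr_gt0 ?exprn_gt0//; rewrite /w; lra.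
have : (\int[lebesgue_measure]_x (landscape D1 0 x * landscape D2 0 x)%:E <=
        landscape_inner (landscape D1) (landscape D2))%E.
  apply: (le_trans _ (nneseries_lim_ge 1%N _)); first by rewrite big_nat1.
  by move=> j _ _; apply: integral_ge0 => x _; exact: f0.
by move: orth; rewrite /orthogonal_diagrams => ->; rewrite leNgt => /negP.
Qed.
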